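(* Let $(\boldsymbol U^{(n)})_{n\ge 0}$ be a sequence in $X_{\mathrm d}$ which satisfies, for every $n\ge 1$ and every $k=0,\dots,N-1$, the linearly implicit scheme $$\frac{U_k^{(n+1)}-U_k^{(n-1)}}{2\Delta t} = -\mathrm{i}\left((-\triangle)_{\mathrm d}^{\frac{\alpha}{2}}\,\frac{\boldsymbol U^{(n+1)}+\boldsymbol U^{(n-1)}}{2}\right)_k + \mathrm{i}\,\bigl|U_k^{(n)}\bigr|^2\,\frac{U_k^{(n+1)}+U_k^{(n-1)}}{2}.$$ Then the discrete mass $\mathcal M_{\mathrm d}$ and the discrete energy $\mathcal H_{\mathrm d}$ are conserved in the sense that, for all $n=1,2,\dots$, $$\mathcal M_{\mathrm d}\bigl(\boldsymbol U^{(n+1)}\bigr)=\mathcal M_{\mathrm d}\bigl(\boldsymbol U^{(n-1)}\bigr),\qquad \mathcal H_{\mathrm d}\bigl(\boldsymbol U^{(n+1)},\boldsymbol U^{(n)}\bigr)=\mathcal H_{\mathrm d}\bigl(\boldsymbol U^{(n)},\boldsymbol U^{(n-1)}\bigr).$$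
   Context: Let $1<\alpha\le 2$, $L>0$, $\Delta t>0$, let $N\ge 1$ be an odd integer, $\Delta x=L/N$, $\mu=2\pi/L$, $\mathrm i=\sqrt{-1}$. $X_{\mathrm d}$ is the space of $N$-periodic complex sequences $\boldsymbol U=\{U_k\}_{k\in\mathbb Z}$, $U_k\in\mathbb C$, $U_k=U_{k \bmod N}$, identified with vectors $(U_0,\dots,U_{N-1})^\top\in\mathbb C^N$. The unitary discrete Fourier transform is $(\mathcal F_{\mathrm d}\boldsymbol U)_k=\frac1{\sqrt N}\sum_{j=0}^{N-1}U_j e^{-2\pi \mathrm i jk/N}$, with inverse $(\mathcal F_{\mathrm d}^{-1}\hat{\boldsymbol U})_j=\frac1{\sqrt N}\sum_{k=0}^{N-1}\hat U_k e^{2\pi \mathrm i jk/N}$. For a real exponent $\beta>0$ let $D_\beta=\mathrm{diag}(d_0,\dots,d_{N-1})$ with $d_p=|\mu p|^\beta$ for $0\le p\le \frac{N-1}{2}$ and $d_p=|\mu(p-N)|^\beta$ for $\frac{N+1}{2}\le p\le N-1$. The discrete fractional Laplacian is $(-\triangle)_{\mathrm d}^{\frac{\beta}{2}}=\mathcal F_{\mathrm d}^{-1}D_\beta\mathcal F_{\mathrm d}$; in particular $(-\triangle)_{\mathrm d}^{\frac{\alpha}{2}}=\mathcal F_{\mathrm d}^{-1}D_\alpha\mathcal F_{\mathrm d}$ and $(-\triangle)_{\mathrm d}^{\frac{\alpha}{4}}=\mathcal F_{\mathrm d}^{-1}D_{\alpha/2}\mathcal F_{\mathrm d}$. For $\boldsymbol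 U,\boldsymbol V\in X_{\mathrm d}$, the discrete mass and discrete energy are $$\mathcal M_{\mathrm d}(\boldsymbol U)=\Delta x\sum_{k=0}^{N-1}|U_k|^2,$$ $$\mathcal H_{\mathrm d}(\boldsymbol U,\boldsymbol V)=\Delta x\sum_{k=0}^{N-1}\left(-\frac{\bigl|\bigl((-\triangle)_{\mathrm d}^{\frac{\alpha}{4}}\boldsymbol U\bigr)_k\bigr|^2+\bigl|\bigl((-\triangle)_{\mathrm d}^{\frac{\alpha}{4}}\boldsymbol V\bigr)_k\bigr|^2}{2}+\frac{|U_k|^2|V_k|^2}{2}\right).$$ *)

(* Defs.v *)
From HB Require Import structures.
From mathcomp Require Import all_boot all_order all_algebra.
From mathcomp Require Import complex.
From mathcomp Require Import reals exp trigo.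

Set Implicit Arguments.
Unset Strict Implicit.
Unset Printing Implicit Defensive.

Import Order.TTheory GRing.Theory Num.Theory.

Local Open Scope ring_scope.
Local Open Scope complex_scope.

(* N-periodic complex sequences, identified with the column vectors
   (U_0, ..., U_{N-1})^T; the entry U_k is [U k 0]. *)
Definition Xd (R : realType) (N : nat) := 'cV[R[i]]_N.

(* e^{i t} for real t *)
Definition expi (R : realType) (t : R) : R[i] := cos t +i* sin t.

(* The unitary discrete Fourier transform as a matrix acting on columns. *)
Definition dft (R : realType) (N : nat) : 'M[R[i]]_N :=
  \matrix_(k, j) ((Num.sqrt N%:R)^-1%:C *
                  expi (- (2 * pi * (j * k)%N%:R / N%:R) : R)).

Definition idft (R : realType) (N : nat) : 'M[R[i]]_N :=
  \matrix_(j, k) ((Num.sqrt N%:R)^-1%:C *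
                  expi (2 * pi * (j * k)%N%:R / N%:R : R)).

(* |mu p|^beta with mu = 2 pi / L, where the indices p > (N-1)/2 stand for the
   negative frequencies p - N.  N is meant to be odd.  For beta > 0 the entry
   at p = 0 is 0, since [0 `^ beta = 0]. *)
Definition symbol (R : realType) (N : nat) (L beta : R) (p : 'I_N) : R :=
  let mu := 2 * pi / L in
  if (p <= (N - 1) %/ 2)%N then `|mu * p%:R| `^ beta
  else `|mu * (p%:R - N%:R)| `^ beta.

Definition Dmx (R : realType) (N : nat) (L beta : R) : 'M[R[i]]_N :=
  diag_mx (\row_p (symbol L beta p)%:C).

(* The discrete fractional Laplacian (-Delta)_d^{beta/2}: the parameter is
   beta, the order of the operator, not the exponent beta/2. *)
Definition fraclap (R : realType) (N : nat) (L beta : R) (U : Xd R N) :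
    Xd R N :=
  idft R N *m (Dmx N L beta *m (dft R N *m U)).

(* [Normc.normc] is the modulus with values in R; the generic norm [`|z|] of
   R[i] takes its values in R[i]. *)
Definition mass (R : realType) (N : nat) (L : R) (U : Xd R N) : R :=
  L / N%:R * \sum_(k < N) Normc.normc (U k 0) ^+ 2.

Definition energy (R : realType) (N : nat) (L alpha : R) (U V : Xd R N) : R :=
  L / N%:R * \sum_(k < N)
    (- ((Normc.normc (fraclap L (alpha / 2) U k 0) ^+ 2 +
         Normc.normc (fraclap L (alpha / 2) V k 0) ^+ 2) / 2)
     + Normc.normc (U k 0) ^+ 2 * Normc.normc (V k 0) ^+ 2 / 2).

(* Main.v *)
(* With P = diag |U^(n)|^2 and A the matrix of the fractional Laplacian, the
   scheme reads X - Y = i dt H (X + Y) for X = U^(n+1), Y = U^(n-1) and the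
   Hermitian matrix H = P - A.  Such a Cayley step preserves X^H G X for every G
   commuting with H.  G = 1 gives the mass.  G = H gives the energy: the DFT is
   unitary, so A = B^2 with B the Hermitian operator of half the order, hence
   X^H H X = sum |U^(n)|^2 |X|^2 - |B X|^2. *)
Require Import Defs.
From HB Require Import structures.
From mathcomp Require Import all_boot all_order all_algebra.
From mathcomp Require Import complex.
From mathcomp Require Import reals exp trigo.
From mathcomp Require Import ring lra.

Import Order.TTheory GRing.Theory Num.Theory.

Local Open Scope ring_scope.
Local Open Scope complex_scope.

Local Notation "A ^H" := (map_mx conjc A^T) (at level 8, format "A ^H").

Lemma adjmxM (R : rcfType) (m n p : nat) (A : 'M[R[i]]_(m, n))
    (B : 'M[R[i]]_(n, p)) : (A *m B)^H = B^H *m A^H.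
Proof. by rewrite trmx_mul map_mxM. Qed.

Lemma adjmxK (R : rcfType) (m n : nat) (A : 'M[R[i]]_(m, n)) : A^H^H = A.
Proof. by apply/matrixP => i j; rewrite !mxE conjcK. Qed.

Lemma adjmx_diag_real (R : rcfType) (n : nat) (d : 'I_n -> R) :
  (diag_mx (\row_p (d p)%:C))^H = diag_mx (\row_p (d p)%:C).
Proof.
apply/matrixP => i j; rewrite !mxE eq_sym.
by case: eqP => [->|_]; rewrite ?mulr1n ?mulr0n ?conjc_real ?conjc0.
Qed.

Lemma normc_sqr (R : rcfType) (z : R[i]) :
  (Normc.normc z ^+ 2)%:C = conjc z * z.
Proof.
case: z => a b; rewrite /Normc.normc sqr_sqrtr ?addr_ge0 ?sqr_ge0 //.
by apply/eqP; rewrite eq_complex /=; apply/andP; split; apply/eqP; ring.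
Qed.

Lemma adjmx_mul_self (R : rcfType) (n : nat) (X : 'cV[R[i]]_n) :
  (X^H *m X) 0 0 = (\sum_k Normc.normc (X k 0) ^+ 2)%:C.
Proof.
rewrite mxE rmorph_sum; apply: eq_bigr => k _.
by rewrite !mxE -normc_sqr.
Qed.

Lemma adjmx_mul_diag (R : rcfType) (n : nat) (d : 'I_n -> R) (X : 'cV[R[i]]_n) :
  (X^H *m (diag_mx (\row_p (d p)%:C) *m X)) 0 0 =
  (\sum_k d k * Normc.normc (X k 0) ^+ 2)%:C.
Proof.
rewrite mxE rmorph_sum; apply: eq_bigr => k _.
by rewrite mul_diag_mx !mxE rmorphM /= normc_sqr; ring.
Qed.

(* Polarization: with D = X - Y and S = X + Y, the difference of the two sides
   is (D^H G S + S^H G D) / 2, and D = i c H S makes both terms cancel. *)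
Lemma crank_nicolson_invariant (R : rcfType) (n : nat) (H G : 'M[R[i]]_n)
    (c : R) (X Y : 'cV[R[i]]_n) (Hadj : H^H = H) (GH : G *m H = H *m G)
    (XY : X - Y = ('i%C * c%:C) *: (H *m (X + Y))) :
  X^H *m (G *m X) = Y^H *m (G *m Y).
Proof.
have ic : conjc ('i%C * c%:C : R[i]) = - ('i%C * c%:C).
  by apply/eqP; rewrite eq_complex /=; apply/andP; split; apply/eqP; ring.
have adjXY : X^H - Y^H = - ('i%C * c%:C) *: ((X + Y)^H *m H).
  rewrite -[in RHS]Hadj -adjmxM -ic.
  move: (congr1 (fun A : 'cV_n => A^H) XY) => /matrixP e.
  by apply/matrixP => i j; move: (e i j); rewrite !mxE rmorphB rmorphM.
have e : (X^H - Y^H) *m (G *m (X + Y)) + (X + Y)^H *m (G *m (X - Y)) = 0.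
  rewrite adjXY XY -!scalemxAr -scalemxAl -!mulmxA (mulmxA G H) GH -!mulmxA.
  by rewrite scaleNr addNr.
apply/eqP; rewrite -subr_eq0.
have : 2 *: (X^H *m (G *m X) - Y^H *m (G *m Y)) = 0.
  rewrite -e (_ : (X + Y)^H = X^H + Y^H); last by rewrite linearD map_mxD.
  rewrite !(mulmxDr, mulmxN, mulmxDl, mulNmx).
  apply/matrixP => i j; rewrite !mxE.
  by ring.
by move/eqP; rewrite scaler_eq0 pnatr_eq0.
Qed.

Lemma expi0 (R : realType) : expi (0 : R) = 1.
Proof. by rewrite /expi cos0 sin0. Qed.

Lemma expiD (R : realType) (t s : R) : expi (t + s) = expi t * expi s.
Proof.
by rewrite /expi cosD sinD; apply/eqP; rewrite eq_complex /= eqxx /= addrC mulrC.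
Qed.

Lemma expiN (R : realType) (t : R) : expi (- t) = conjc (expi t).
Proof. by rewrite /expi cosN sinN. Qed.

Lemma expiMn (R : realType) (t : R) (n : nat) : expi (t *+ n) = expi t ^+ n.
Proof.
by elim: n => [|n IH]; rewrite ?mulr0n ?expi0 // mulrS expiD IH exprS.
Qed.

Lemma expi2pi (R : realType) : expi (pi *+ 2 : R) = 1.
Proof. by rewrite /expi cos2pi sin2pi. Qed.

(** For [0 < t < 2 pi], [cos t = 2 cos^2 (t / 2) - 1 = 1] would force [sin (t / 2) = 0], while the
    sine is positive on [(0, pi)]. Conjugation reduces negative [t] to this case. *)
Lemma expi_eq1 (R : realType) (t : R) : `|t| < pi *+ 2 -> expi t = 1 -> t = 0.
Proof.
wlog t0 : t / 0 <= t => [th|].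
  case: (leP 0 t) => [/th //|tlt0 tb te].
  apply/eqP; rewrite -oppr_eq0; apply/eqP; apply: th.
  - by rewrite oppr_ge0 ltW.
  - by rewrite normrN.
  - by rewrite expiN te conjc1.
rewrite ger0_norm // => tb [ct _]; apply/eqP; move: t0.
rewrite le_eqVlt => /orP[/eqP <- //|t0].
have s0 : 0 < sin (t / 2).
  by apply: sin_gt0_pi; move: tb; rewrite mulr2n; lra.
have := cos2Dsin2 (t / 2).
move: ct; rewrite (_ : t = (t / 2) *+ 2); last by rewrite mulr2n; lra.
rewrite cos_mulr2n (_ : (t / 2) *+ 2 / 2 = t / 2); last by rewrite mulr2n; lra.
by move=> h1 h2; nra.
Qed.

(** A geometric sum whose ratio [w] is an [N]-th root of unity: [(w - 1)] times the sum is
    [w ^+ N - 1 = 0]. For [k != l] the angle of [w] is nonzero and below [2 pi] in modulus because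
    [|l - k| < N], so [w != 1] by [expi_eq1]. *)
Lemma sum_expi (R : realType) (N : nat) (k l : 'I_N) :
  \sum_(j < N) expi (2 * pi * (l%:R - k%:R) / N%:R : R) ^+ j =
  if k == l then N%:R else 0.
Proof.
have N0 : (N%:R : R) != 0 by rewrite pnatr_eq0 -lt0n (leq_ltn_trans _ (ltn_ord k)).
case: eqP => [->|/eqP kl].
  rewrite subrr mulr0 mul0r expi0.
  by under eq_bigr do rewrite expr1n; rewrite sumr_const card_ord.
set w := expi _.
have wN : w ^+ N = 1.
  rewrite -expiMn -(mulr_natr (_ / _)) divfK // -[RHS](expr1n _ l) -expi2pi -expiMn.
  (* [l - k] may be negative, while [expiMn] takes natural multiples only; hence the split into two
     full-turn angles. *)
  have -> : 2 * pi * (l%:R - k%:R) = pi *+ 2 *+ l - pi *+ 2 *+ k :> R.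
    by ring.
  by rewrite expiD expiN !(expiMn _ (pi *+ 2)) expi2pi !expr1n conjc1 mulr1.
have w1 : w - 1 != 0.
  rewrite subr_eq0; apply/eqP => /expi_eq1 h.
  have Npos : (0 : R) < N%:R by rewrite lt_neqAle eq_sym N0 ler0n.
  have lk : `|l%:R - k%:R : R| < N%:R.
    have [lN kN] := (ltn_ord l, ltn_ord k).
    rewrite ltr_norml; move: (ler0n R l) (ler0n R k).
    move: lN kN; rewrite -!(ltr_nat R); lra.
  have : 2 * pi * (l%:R - k%:R) / N%:R = 0 :> R.
    apply: h; rewrite normrM normfV (ger0_norm (ler0n _ N)) ltr_pdivrMr //.
    rewrite normrM ger0_norm ?mulr_ge0 ?pi_ge0 // mulr_natl ltr_pM2l //.
    by rewrite mulrn_wgt0 // pi_gt0.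
  move/eqP; rewrite !mulf_eq0 invr_eq0 (negbTE N0) orbF.
  rewrite pnatr_eq0 (gt_eqF (pi_gt0 R)) /= subr_eq0 eqr_nat => /eqP e.
  by move/eqP: kl; apply; apply: val_inj; rewrite /= e.
by apply: (mulfI w1); rewrite -subrX1 wN subrr mulr0.
Qed.

(** Discrete orthogonality of the characters: entry [(k, l)] is a geometric sum with frequency
    [l - k], and the two factors [1 / sqrt N] cancel its diagonal value [N]. *)
Lemma dftK (R : realType) (N : nat) : dft R N *m idft R N = 1%:M.
Proof.
apply/matrixP => k l; rewrite !mxE.
have Npos : (0 < N)%N by apply: leq_ltn_trans (ltn_ord k).
have N0 : (N%:R : R) != 0 by rewrite pnatr_eq0 -lt0n.
pose c : R[i] := (Num.sqrt N%:R)^-1%:C.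
have cN : c * c * N%:R = 1.
  rewrite -(rmorph_nat (real_complex R)) -!rmorphM /= -expr2 exprVn sqr_sqrtr ?ler0n //.
  by rewrite mulVf.
transitivity (c * c * \sum_(j < N) expi (2 * pi * (l%:R - k%:R) / N%:R : R) ^+ j).
  rewrite mulr_sumr; apply: eq_bigr => j _; rewrite !mxE -/c mulrACA -expiD.
  congr (_ * _); rewrite -expiMn; congr expi.
  by rewrite -mulr_natr !natrM; field.
by rewrite sum_expi; case: eqP => _; rewrite ?mulr0 ?cN.
Qed.

(** The kernel is symmetric in [j] and [k], and conjugation flips the sign of its phase. The
    fractional Laplacian thus has the form [F^H D F] with [D] real diagonal, which makes it
    Hermitian. *)
Lemma adjmx_dft (R : realType) (N : nat) : (dft R N)^H = idft R N.
Proof.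
apply/matrixP => j k; rewrite !mxE rmorphM; congr (_ * _); first exact: conjc_real.
by rewrite -[LHS]/(conjc (expi _)) -expiN opprK mulnC.
Qed.

Lemma symbol_half (R : realType) (N : nat) (L a : R) (p : 'I_N) :
  a != 0 -> symbol L (a / 2) p ^+ 2 = symbol L a p.
Proof.
move=> a0; rewrite /symbol.
by case: ifP => _; rewrite -powR_mulrn ?powR_ge0 // -powRrM divfK ?pnatr_eq0.
Qed.

(** The operator as a matrix, so that its adjoint and its square make sense. *)
Definition fraclap_mx {R : realType} (N : nat) (L b : R) : 'M[R[i]]_N :=
  idft R N *m (Dmx N L b *m dft R N).

Lemma fraclapE (R : realType) (N : nat) (L b : R) (U : Xd R N) :
  fraclap L b U = fraclap_mx N L b *m U.
Proof. by rewrite /fraclap /fraclap_mx !mulmxA. Qed.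

Lemma adjmx_fraclap (R : realType) (N : nat) (L b : R) :
  (fraclap_mx N L b)^H = fraclap_mx N L b.
Proof.
by rewrite /fraclap_mx !adjmxM -adjmx_dft adjmxK adjmx_diag_real -mulmxA.
Qed.

(** The inner transforms cancel by [dftK], so squaring acts on the symbol alone. *)
Lemma fraclap_mx_half (R : realType) (N : nat) (L a : R) :
  a != 0 ->
  fraclap_mx N L (a / 2) *m fraclap_mx N L (a / 2) = fraclap_mx N L a.
Proof.
move=> a0; rewrite /fraclap_mx -!mulmxA (mulmxA (dft R N) (idft R N)) dftK mul1mx.
congr (_ *m _); rewrite mulmxA; congr (_ *m _).
apply/matrixP => i j; rewrite mul_diag_mx !mxE.
case: eqP => [->|_]; rewrite ?mulr1n ?mulr0n ?mulr0 //.
by rewrite -rmorphM /= -expr2 symbol_half.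
Qed.

Lemma fraclap_form (R : realType) (N : nat) (L a : R) (X : Xd R N) :
  a != 0 ->
  (X^H *m (fraclap_mx N L a *m X)) 0 0 =
  (\sum_k Normc.normc (fraclap L (a / 2) X k 0) ^+ 2)%:C.
Proof.
move=> a0; rewrite -fraclap_mx_half // -adjmx_mul_self fraclapE adjmxM.
by rewrite adjmx_fraclap -!mulmxA.
Qed.

(** The first two sums are grouped to form [X^H H X] with potential [|Z|^2]; the last one depends on
    [Z] only. *)
Lemma energyE (R : realType) (N : nat) (L a : R) (X Z : Xd R N) :
  energy L a Z X = L / N%:R *
    ((\sum_k Normc.normc (Z k 0) ^+ 2 * Normc.normc (X k 0) ^+ 2 -
      \sum_k Normc.normc (fraclap L (a / 2) X k 0) ^+ 2 -
      \sum_k Normc.normc (fraclap L (a / 2) Z k 0) ^+ 2) / 2).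
Proof.
rewrite /energy -!sumrB mulr_suml; congr (_ * _); apply: eq_bigr => k _.
by field.
Qed.

Lemma energyC (R : realType) (N : nat) (L a : R) (X Z : Xd R N) :
  energy L a X Z = energy L a Z X.
Proof. by congr (_ * _); apply: eq_bigr => k _; ring. Qed.

Theorem theorem2 (R : realType) (alpha L dt : R) (N : nat)
    (halpha1 : 1 < alpha) (halpha2 : alpha <= 2) (hL : 0 < L) (hdt : 0 < dt)
    (hN : (1 <= N)%N) (hNodd : odd N)
    (U : nat -> Xd R N)
    (hU : forall (n : nat) (k : 'I_N), (1 <= n)%N ->
      (U n.+1 k 0 - U n.-1 k 0) / (2 * dt)%:C =
        - 'i%C * fraclap L alpha (2^-1 *: (U n.+1 + U n.-1)) k 0
        + 'i%C * (Normc.normc (U n k 0) ^+ 2)%:C *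
            ((U n.+1 k 0 + U n.-1 k 0) / 2)) :
  forall n : nat, (1 <= n)%N ->
    mass L (U n.+1) = mass L (U n.-1) /\
    energy L alpha (U n.+1) (U n) = energy L alpha (U n) (U n.-1).
Proof.
move=> n n1.
have a0 : alpha != 0 by rewrite gt_eqF // (lt_trans _ halpha1).
set X := U n.+1; set Y := U n.-1; set Z := U n.
pose V : 'M[R[i]]_N := diag_mx (\row_p (Normc.normc (Z p 0) ^+ 2)%:C).
pose H := V - fraclap_mx N L alpha.
have Hadj : H^H = H.
  by rewrite /H linearB map_mxB adjmx_diag_real adjmx_fraclap.
(* The scheme multiplied by [2 dt]: the 2 cancels the halves of both averages, leaving the constant
   [dt]. *)
have step : X - Y = ('i%C * dt%:C) *: (H *m (X + Y)).
  apply/matrixP => k j; rewrite (ord1 j).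
  have dt0 : (2 * dt)%:C != 0 :> R[i].
    by rewrite (fmorph_eq0 (real_complex R)) mulf_neq0 ?pnatr_eq0 ?gt_eqF.
  move: (hU n k n1) => /(canRL (mulfVK dt0)).
  rewrite -/X -/Y -/Z fraclapE -scalemxAr /H mulmxBl mul_diag_mx.
  have -> : (2 * dt)%:C = 2 * dt%:C :> R[i] by rewrite rmorphM rmorph_nat.
  rewrite !mxE => ->.
  by field.
have mass_inv := crank_nicolson_invariant _ _ H 1%:M dt X Y Hadj
  (etrans (mul1mx _) (esym (mulmx1 _))) step.
have energy_inv := crank_nicolson_invariant _ _ H H dt X Y Hadj erefl step.
split.
  move: mass_inv; rewrite !mul1mx => /matrixP /(_ 0 0).
  by rewrite !adjmx_mul_self /mass => -[->].
have form W : (W^H *m (H *m W)) 0 0 =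
    (\sum_k Normc.normc (Z k 0) ^+ 2 * Normc.normc (W k 0) ^+ 2 -
     \sum_k Normc.normc (fraclap L (alpha / 2) W k 0) ^+ 2)%:C.
  rewrite /H mulmxBl mulmxBr rmorphB [LHS]mxE [X in _ + X = _]mxE.
  by congr (_ - _); [exact: adjmx_mul_diag | exact: fraclap_form].
move: energy_inv => /matrixP /(_ 0 0).
rewrite (form X) (form Y) => /complexI e.
(* Symmetry puts the common iterate [Z] first in both energies, so they differ only in the invariant
   form [e]. *)
by rewrite (energyC _ _ L alpha X) !energyE e.
Qed.
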